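(* Let $\hat x_0,\dots,\hat x_{T-1}$ be the decisions produced by AdaScale (defined in the context). Then $$\frac1T\sum_{t=0}^{T-1}\frac{d\sigma_n^2}{h_{\min,t}^2}\Big(\frac1{\hat x_t}-\frac1{x_{\max}}\Big)-\nu\le\frac{Q_T^{\max}}{T},$$ where $$Q_T^{\max}=\Big(2V\sum_{t=0}^{T-1}\sum_{m=1}^M\rho_\alpha(q_m,\sigma_{m,t}^{\min})+T\nu^2\Big)^{1/2},\qquad \sigma_{m,t}^{\min}=\frac{\sigma_nMB_m}{G\,h_{\min,t}\sqrt{2x_{\max}}}.$$
   Context: Parameters: integers $M,T,d\ge1$ and $\alpha>1$; reals $\sigma_n,G,P_{\max},V>0$ and $\nu\ge0$; integers $1\le B_m\le n_m$ and $q_m=B_m/n_m$, $k_m=\sqrt{1+(1-q_m)/B_m}$ for $m=1,\dots,M$; nonzero channel coefficients $h_{m,t}\in\mathbb{C}$ for $1\le m\le M$, $0\le t\le T-1$. Put $h_{\min,t}=\min_m\frac{|h_{m,t}|}{k_m}$ and $x_{\max}=\frac{P_{\max}dM^2}{G^2}$. For $q\in(0,1]$, $\sigma>0$: $\rho_\alpha(q,\sigma)=\frac{1}{\alpha-1}\ln\big[\sum_{k=0}^{\alpha}\binom{\alpha}{k}(1-q)^{\alpha-k}q^k\exp\big(\frac{k^2-k}{2\sigma^2}\big)\big]$ (with $0^0=1$). For $x>0$: $\sigma_{m,t}(x)=\frac{MB_m\sigma_n}{\sqrt{2x}\,G\,h_{\min,t}}$. AdaScale: start with $Q_0=0$. For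 $t=0,\dots,T-1$, let $\hat x_t$ be a minimizer over $x\in(0,x_{\max}]$ of $$V\sum_{m=1}^M\rho_\alpha(q_m,\sigma_{m,t}(x))+Q_t\frac{d\sigma_n^2}{h_{\min,t}^2}\Big(\frac1x-\frac1{x_{\max}}\Big)+\frac12\Big(\frac{d\sigma_n^2}{h_{\min,t}^2}\Big)^2\Big(\frac1x-\frac1{x_{\max}}\Big)^2,$$ and update the virtual queue $Q_{t+1}=\max\big\{Q_t+\frac{d\sigma_n^2}{h_{\min,t}^2}\big(\frac1{\hat x_t}-\frac1{x_{\max}}\big)-\nu,\,0\big\}$. The left-hand side of the claim is the amount by which AdaScale violates the long-term constraint $\frac1T\sum_{t}\frac{d\sigma_n^2}{h_{\min,t}^2}\big(\frac1{x_t}-\frac1{x_{\max}}\big)\le\nu$. *)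

(* Defs.v *)
From mathcomp Require Import all_boot all_order all_algebra.
From mathcomp Require Import all_classical all_reals all_analysis.
From mathcomp Require Import complex.

Set Implicit Arguments.
Unset Strict Implicit.
Unset Printing Implicit Defensive.

Import Order.TTheory GRing.Theory Num.Theory.
Import ComplexField.Normc.

Local Open Scope ring_scope.

(* Data only: positivity and range constraints are hypotheses of the theorem.
   Time is a [nat]; a horizon [T] restricts it to [t < T] where it matters. *)
Record setting (R : realType) := Setting {
  num_devices : nat;                      (* M *)
  model_dim : nat;                        (* d *)
  renyi_order : nat;                      (* alpha *)
  noise_std : R;                          (* sigma_n *)
  grad_bound : R;                         (* G *)
  Pmax : R;
  weight : R;                             (* V *)
  budget : R;                             (* nu *)
  batch_size : 'I_num_devices -> nat;     (* B_m *)
  data_size : 'I_num_devices -> nat;      (* n_m *)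
  channel : 'I_num_devices -> nat -> R[i] }. (* h_{m,t} *)

Definition rho (R : realType) (alpha : nat) (q sigma : R) : R :=
  (alpha%:R - 1)^-1 *
  ln (\sum_(k < alpha.+1) 'C(alpha, k)%:R * (1 - q) ^+ (alpha - k) * q ^+ k *
        expR ((k%:R ^+ 2 - k%:R) / (2 * sigma ^+ 2))).

Definition is_minimizer (R : realType) (A : set R) (f : R -> R) (a : R) : Prop :=
  A a /\ forall b, A b -> f a <= f b.

Section AdaScale.
Context {R : realType} (s : setting R).

Definition sampling_rate (m : 'I_(num_devices s)) : R :=
  (batch_size m)%:R / (data_size m)%:R.

Definition kfactor (m : 'I_(num_devices s)) : R :=
  Num.sqrt (1 + (1 - sampling_rate m) / (batch_size m)%:R).

(* The starting value of the iterated minimum is the first element, so this is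
   the minimum over all devices as soon as there is one. *)
Definition h_min (t : nat) : R :=
  let g := [seq normc (channel m t) / kfactor m
           | m <- enum 'I_(num_devices s)] in
  \big[Num.min/head 0 g]_(y <- g) y.

Definition x_max : R :=
  Pmax s * (model_dim s)%:R * (num_devices s)%:R ^+ 2 / grad_bound s ^+ 2.

Definition sigma (m : 'I_(num_devices s)) (t : nat) (x : R) : R :=
  (num_devices s)%:R * (batch_size m)%:R * noise_std s /
  (Num.sqrt (2 * x) * grad_bound s * h_min t).

Definition sigma_min (m : 'I_(num_devices s)) (t : nat) : R :=
  noise_std s * (num_devices s)%:R * (batch_size m)%:R /
  (grad_bound s * h_min t * Num.sqrt (2 * x_max)).

Definition excess (t : nat) (x : R) : R :=
  (model_dim s)%:R * noise_std s ^+ 2 / h_min t ^+ 2 * (x^-1 - x_max^-1).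

(* [Q] is the current length of the virtual queue. *)
Definition objective (t : nat) (Q x : R) : R :=
  weight s * (\sum_(m < num_devices s)
                rho (renyi_order s) (sampling_rate m) (sigma m t x))
  + Q * excess t x
  + 2^-1 * ((model_dim s)%:R * noise_std s ^+ 2 / h_min t ^+ 2) ^+ 2
         * (x^-1 - x_max^-1) ^+ 2.

Fixpoint queue (x : nat -> R) (t : nat) : R :=
  if t is t'.+1 then
    Num.max (queue x t' + excess t' (x t') - budget s) 0
  else 0.

(* [queue x t] depends only on the decisions before time [t], so this describes
   exactly the possible outputs of the recursive procedure, for every choice
   of minimizers. *)
Definition AdaScale (T : nat) (x : nat -> R) : Prop :=
  forall t, (t < T)%N ->
    is_minimizer `]0, x_max]%classic (objective t (queue x t)) (x t).

Definition Qmax (T : nat) : R :=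
  Num.sqrt (2 * weight s *
              (\sum_(t < T) \sum_(m < num_devices s)
                 rho (renyi_order s) (sampling_rate m) (sigma_min m t))
            + T%:R * budget s ^+ 2).

End AdaScale.

(* Main.v *)
(* Comparing the minimizer [x t] with the candidate [x_max], whose excess is 0,
   and dropping the Renyi terms, which are nonnegative, gives
     Q_t e_t + e_t^2 / 2 <= V \sum_m rho(q_m, sigma_min_{m,t})
   for the excess e_t >= 0.  Hence the drift of the squared queue satisfies
     Q_{t+1}^2 - Q_t^2 <= 2 (Q_t e_t + e_t^2 / 2) + nu^2,
   and summing over t bounds Q_T by [Qmax], while Q_T dominates the accumulated
   violation \sum_t (e_t - nu). *)

Require Import Defs.
From mathcomp Require Import all_boot all_order all_algebra.
From mathcomp Require Import all_classical all_reals all_analysis.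
From mathcomp Require Import complex.
From mathcomp Require Import ring lra.

Import Order.TTheory GRing.Theory Num.Theory.

Local Open Scope ring_scope.

Lemma sum_binomial_weights {R : comNzRingType} (q : R) (n : nat) :
  \sum_(k < n.+1) 'C(n, k)%:R * (1 - q) ^+ (n - k) * q ^+ k = 1.
Proof.
transitivity ((1 - q + q) ^+ n); last by rewrite subrK expr1n.
rewrite exprDn; apply: eq_bigr => k _.
by rewrite -mulrA mulr_natl.
Qed.

(** The binomial weights sum to 1 and every exponential factor is at least 1, so the argument of the
    logarithm is at least 1. *)
Lemma rho_ge0 {R : realType} (alpha : nat) (q sigma : R) :
  (1 < alpha)%N -> 0 <= q <= 1 -> 0 <= rho alpha q sigma.
Proof.
move=> alpha_gt1 /andP[q_ge0 q_le1]; rewrite /rho mulr_ge0//.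
  by rewrite invr_ge0 subr_ge0 ler1n ltnW.
apply: ln_ge0; rewrite -[leLHS](sum_binomial_weights q alpha).
apply: ler_sum => k _; apply: ler_peMr.
  by rewrite !mulr_ge0 ?exprn_ge0 ?subr_ge0.
rewrite -[leLHS]expR0 ler_expR divr_ge0 ?(mulr_ge0 _ (sqr_ge0 _))//.
(* The exponent is nonnegative because [k <= k ^ 2] in the naturals; [k = 0] is split off. *)
by rewrite subr_ge0 -natrX ler_nat; case: (nat_of_ord k) => // n; rewrite leq_pmulr.
Qed.

Section QueueBounds.
Context {R : realType} {s : setting R}.

Lemma sampling_rate_itv (m : 'I_(num_devices s)) :
  (1 <= batch_size m <= data_size m)%N -> 0 <= sampling_rate m <= 1.
Proof.
move=> /andP[B_ge1 B_le]; rewrite /sampling_rate divr_ge0//=.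
by rewrite ler_pdivrMr ?mul1r ?ler_nat// ltr0n (leq_trans B_ge1).
Qed.

Lemma sigma_x_max (m : 'I_(num_devices s)) (t : nat) :
  sigma m t (x_max s) = sigma_min m t.
Proof. by rewrite /sigma /sigma_min; congr (_ / _); ring. Qed.

Lemma excess_ge0 (t : nat) (x : R) : 0 < x <= x_max s -> 0 <= excess s t x.
Proof.
move=> /andP[x_gt0 x_le]; rewrite /excess mulr_ge0 ?divr_ge0 ?(mulr_ge0 _ (sqr_ge0 _)) ?sqr_ge0//.
by rewrite subr_ge0 lef_pV2 ?posrE// (lt_le_trans x_gt0).
Qed.

(** The quadratic penalty is half the squared excess, so the last two terms form exactly the
    quantity that bounds the queue drift. *)
Lemma objectiveE (t : nat) (Q x : R) :
  objective s t Q x =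
  weight s * (\sum_(m < num_devices s)
                rho (renyi_order s) (sampling_rate m) (sigma m t x))
  + (Q * excess s t x + 2^-1 * excess s t x ^+ 2).
Proof. by rewrite /objective -addrA -mulrA -exprMn. Qed.

Lemma minimizer_excess_le {t : nat} {Q x : R} :
  (1 < renyi_order s)%N -> 0 < x_max s -> 0 <= weight s ->
  (forall m : 'I_(num_devices s), 0 <= sampling_rate m <= 1) ->
  is_minimizer `]0, x_max s]%classic (objective s t Q) x ->
  Q * excess s t x + 2^-1 * excess s t x ^+ 2 <=
  weight s * (\sum_(m < num_devices s)
                rho (renyi_order s) (sampling_rate m) (sigma_min m t)).
Proof.
move=> alpha_gt1 xmax_gt0 V_ge0 q_itv [_ x_min].
have /x_min : `]0, x_max s]%classic (x_max s) by rewrite /= in_itv/= xmax_gt0 lexx.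
have excess_x_max : excess s t (x_max s) = 0 by rewrite /excess subrr mulr0.
rewrite !objectiveE excess_x_max expr0n/= !mulr0 !addr0.
under [X in _ <= _ * X]eq_bigr do rewrite sigma_x_max.
(* It remains to see that adding the weighted Renyi terms at [x] only enlarges the left side. *)
apply: le_trans; rewrite lerDr mulr_ge0// sumr_ge0// => m _.
exact: rho_ge0.
Qed.

Lemma queue_ge0 (x : nat -> R) (t : nat) : 0 <= queue s x t.
Proof. by case: t => [|t] //=; rewrite le_max lexx orbT. Qed.

(** Each update raises the queue by at least the excess minus [budget s], since the maximum
    dominates its first argument. *)
Lemma sum_excess_le_queue (x : nat -> R) (T : nat) :
  \sum_(t < T) excess s t (x t) - T%:R * budget s <= queue s x T.
Proof.
elim: T => [|T IH]; first by rewrite big_ord0 mul0r subr0.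
rewrite big_ord_recr /= le_max; apply/orP; left.
rewrite -natr1; lra.
Qed.

Lemma queue_sqr_drift {x : nat -> R} {t : nat} :
  0 <= budget s -> 0 <= excess s t (x t) ->
  queue s x t.+1 ^+ 2 <= queue s x t ^+ 2 + budget s ^+ 2
    + 2 * (queue s x t * excess s t (x t) + 2^-1 * excess s t (x t) ^+ 2).
Proof.
move=> nu_ge0 e_ge0; rewrite [queue s x t.+1]/=.
have Q_ge0 := queue_ge0 x t.
set Q := queue s x t in Q_ge0 *; set e := excess s t (x t) in e_ge0 *.
have Qnu_ge0 : 0 <= Q * budget s by rewrite mulr_ge0.
have enu_ge0 : 0 <= e * budget s by rewrite mulr_ge0.
(* Truncation at 0 cannot increase the square; expanding it leaves the cross terms
   [- 2 * Q * budget s] and [- 2 * e * budget s], both nonpositive. *)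
apply: (@le_trans _ _ ((Q + e - budget s) ^+ 2)).
  by case: (leP (Q + e - budget s) 0) => _ //; rewrite expr0n sqr_ge0.
lra.
Qed.

Lemma queue_le_Qmax (x : nat -> R) (T : nat) :
  (1 < renyi_order s)%N -> 0 < x_max s -> 0 <= weight s -> 0 <= budget s ->
  (forall m : 'I_(num_devices s), 0 <= sampling_rate m <= 1) ->
  AdaScale s T x -> queue s x T <= Qmax s T.
Proof.
move=> alpha_gt1 xmax_gt0 V_ge0 nu_ge0 q_itv x_AdaScale.
(* With the queue written as the root of its square, it suffices to compare radicands, which grow
   additively in [T]. *)
rewrite -[leLHS]ger0_norm ?queue_ge0// -sqrtr_sqr /Qmax; apply: ler_wsqrtr.
elim: T x_AdaScale => [|T IH] x_AdaScale.
  by rewrite big_ord0 mulr0 mul0r addr0 expr0n.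
have {}IH := IH (fun t tT => x_AdaScale t (ltnW tT)).
have x_min := x_AdaScale T (ltnSn T).
have e_ge0 : 0 <= excess s T (x T).
  by apply: excess_ge0; case: x_min => /=; rewrite in_itv.
have := minimizer_excess_le alpha_gt1 xmax_gt0 V_ge0 q_itv x_min.
have := queue_sqr_drift nu_ge0 e_ge0.
rewrite big_ord_recr/= -natr1; lra.
Qed.

End QueueBounds.

Theorem theorem2 (R : realType) (s : setting R) (T : nat) (x : nat -> R)
  (M_ge1 : (1 <= num_devices s)%N)
  (T_ge1 : (1 <= T)%N)
  (d_ge1 : (1 <= model_dim s)%N)
  (alpha_gt1 : (1 < renyi_order s)%N)
  (sigma_n_gt0 : 0 < noise_std s)
  (G_gt0 : 0 < grad_bound s)
  (Pmax_gt0 : 0 < Pmax s)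
  (V_gt0 : 0 < weight s)
  (nu_ge0 : 0 <= budget s)
  (B_range : forall m : 'I_(num_devices s), (1 <= batch_size m <= data_size m)%N)
  (h_neq0 : forall (m : 'I_(num_devices s)) (t : nat), (t < T)%N -> channel m t != 0)
  (x_AdaScale : AdaScale s T x) :
  T%:R^-1 * (\sum_(t < T)
               (model_dim s)%:R * noise_std s ^+ 2 / h_min s t ^+ 2
               * ((x t)^-1 - (x_max s)^-1))
    - budget s
  <= Qmax s T / T%:R.
Proof.
have T_gt0 : 0 < T%:R :> R by rewrite ltr0n.
have xmax_gt0 : 0 < x_max s by rewrite /x_max divr_gt0 ?mulr_gt0 ?exprn_gt0 ?ltr0n.
have q_itv (m : 'I_(num_devices s)) : 0 <= sampling_rate m <= 1.
  exact: sampling_rate_itv.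
(* Multiplying by [T] turns the average into the accumulated violation, whose summands are [excess]
   unfolded. *)
rewrite ler_pdivlMr// mulrBl mulrAC mulVf ?gt_eqF// mul1r [budget s * _]mulrC.
apply: le_trans (sum_excess_le_queue x T) _.
by apply: queue_le_Qmax => //; exact: ltW.
Qed.
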